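(* In the cell-probe model with any word size $w$ and an alphabet whose size is polynomial in $n$, the online edit distance problem can be solved in $$O\!\left(\frac{\log^2 n}{w}\right)$$ amortised cell probes per output.
   Context: Cell-probe model: memory is an unbounded array of cells of $w$ bits each. The cost of an algorithm is the number of cells it reads or writes (cell probes); all computation is free. The algorithm may process the fixed string $F$ in a preprocessing phase before the first stream symbol arrives; the stated bound counts the cell probes performed while processing the stream, amortised over the arrivals. Online edit distance problem: a fixed string $F$ of length $n$ is given, and stream symbols $S[0],S[1],\dots$ arrive one at a time. $\mathrm{Edit}(A,B)$ is the minimum number of single-symbol replacements, deletions and insertions needed to transform $A$ into $B$. Immediately after $S[i]$ arrives, the algorithm outputs $\min_{h\le i}\mathrm{Edit}(F,S[h,i])$, where $S[h,i]$ denotes $S[h]S[h+1]\cdots S[i]$.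
   Formalization: Besides the charged cells, the algorithm keeps one free w-bit register between arrivals and its per-arrival computation may depend on F without probing; otherwise amortised cost below one probe, claimed when w far exceeds log² n, would be impossible. *)

(* Defs.v *)
From mathcomp Require Import all_boot all_order all_algebra.
From mathcomp Require Import boolp reals exp.

Set Implicit Arguments.
Unset Strict Implicit.
Unset Printing Implicit Defensive.

Section EditDistance.
Variable T : Type.
Implicit Types (A B C : seq T) (S : nat -> T).

Inductive edit_step : seq T -> seq T -> Prop :=
| Replace p s a b : edit_step (p ++ a :: s) (p ++ b :: s)
| Delete p s a : edit_step (p ++ a :: s) (p ++ s)
| Insert p s b : edit_step (p ++ s) (p ++ b :: s).

(* [edits k A B]: some sequence of exactly [k] operations turns [A] into [B] *)
Inductive edits : nat -> seq T -> seq T -> Prop :=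
| Edits0 A : edits 0 A A
| EditsS k A B C : edit_step A B -> edits k B C -> edits k.+1 A C.

Lemma edits_ex A B : exists k, `[< edits k A B >].
Proof.
suff [k AB] : exists k, edits k A B by exists k; apply/asboolP.
elim: A => [|a A [k AB]]; last first.
  by exists k.+1; apply: EditsS AB; apply: (@Delete [::]).
suff H C : exists k, edits k C (C ++ B) by apply: (H [::]).
elim: B C => [|b B IH] C; first by exists 0; rewrite cats0; exact: Edits0.
have [k CB] := IH (rcons C b); exists k.+1.
rewrite -cat_rcons; apply: EditsS CB.
by have := @Insert C [::] b; rewrite cats0 cats1.
Qed.

Definition Edit A B : nat := ex_minn (edits_ex A B).

(* S[h,i], both ends included *)
Definition substream S (h i : nat) : seq T := map S (index_iota h i.+1).

(* The default value of the minimum is the term for h = i. *)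
Definition online_edit A S (i : nat) : nat :=
  \big[minn/Edit A (substream S i i)]_(h < i.+1) Edit A (substream S h i).

End EditDistance.

Section CellProbe.
Variable w : nat.

Definition word := w.-tuple bool.
Definition memory := nat -> word.

Definition write (m : memory) (a : nat) (v : word) : memory :=
  fun b => if b == a then v else m b.

(* A computation returning an [X]. Only [Read] and [Write] are charged; each
   address and each written value may be any function of what was read. *)
Inductive program (X : Type) : Type :=
| Return of X
| Read of nat & (word -> program X)
| Write of nat & word & program X.

Fixpoint result X (p : program X) (m : memory) : X :=
  match p with
  | Return x => x
  | Read a k => result (k (m a)) m
  | Write a v p' => result p' (write m a v)
  end.

Fixpoint memory_after X (p : program X) (m : memory) : memory :=
  match p with
  | Return _ => m
  | Read a k => memory_after (k (m a)) m
  | Write a v p' => memory_after p' (write m a v)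
  end.

Fixpoint cost X (p : program X) (m : memory) : nat :=
  match p with
  | Return _ => 0
  | Read a k => (cost (k (m a)) m).+1
  | Write a v p' => (cost p' (write m a v)).+1
  end.

Variables (n : nat) (Sigma : Type).

(* [F] is fixed before the stream starts and computation is free, so
   [on_arrival] may depend on [F]. From one arrival to the next, the only
   information kept about the stream is the memory, whose accesses are charged,
   and one processor register of [w] bits, whose accesses are not. With no such
   register an arrival without a probe could only return a function of the
   current symbol, and amortised costs below one probe would be impossible. *)
Record algorithm := Algorithm {
  preprocess : n.-tuple Sigma -> memory * word;
  on_arrival : n.-tuple Sigma -> word -> Sigma -> program (nat * word)
}.

Variables (alg : algorithm) (F : n.-tuple Sigma) (S : nat -> Sigma).

(* memory and register just before the arrival of S[i] *)
Fixpoint config (i : nat) : memory * word :=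
  match i with
  | 0 => preprocess alg F
  | j.+1 => let: (m, r) := config j in
            let p := on_arrival alg F r (S j) in
            (memory_after p m, (result p m).2)
  end.

Definition arrival_program (i : nat) : program (nat * word) :=
  on_arrival alg F (config i).2 (S i).

Definition output (i : nat) : nat :=
  (result (arrival_program i) (config i).1).1.

Definition probes (i : nat) : nat := cost (arrival_program i) (config i).1.

End CellProbe.

(* Main.v *)
Require Import Defs.
From mathcomp Require Import all_boot all_order all_algebra.
From mathcomp Require Import boolp reals exp.
From mathcomp Require Import zify.

Set Implicit Arguments.
Unset Strict Implicit.
Unset Printing Implicit Defensive.

(** Let [D t j] be the minimum over [h] of the edit distance between the first
    [j] symbols of the pattern and [S[h, t-1]]. The column [a t j = j - D t j]
    is nondecreasing in [j], and the outputs at the next [l] arrivals depend on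
    [a t] only through its truncation at [a t n - 2 l]: each arrival changes
    every value by at most one. The truncated column takes at most [2 l + 1]
    values, so it is coded by [O(l)] jump positions, i.e. [O(l log n)] bits.

    The algorithm keeps such a summary for each level [j <= log n], with
    [l = 2^j l0], and rebuilds it every [2^j l0] arrivals by replaying the
    recent stream symbols from the summary of the next level. Each level costs
    [O((log n) / w)] amortised probes per arrival. With [l0] about
    [w / log n], the level 0 state fits in the register, so that no probe is
    made inside a block of [l0] arrivals when [w] is large. *)

(** * Alignments as an inductive form of edit distance *)

Section Alignment.
Variable T : Type.
Implicit Types (A B C X Y p s : seq T) (k : nat).

(** Grown at the right end only, unlike [edits], so that each constructor matches one case of the
    dynamic programming recurrence. *)
Inductive align : nat -> seq T -> seq T -> Prop :=
| AlignNil : align 0 [::] [::]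
| AlignMatch k A B x : align k A B -> align k (rcons A x) (rcons B x)
| AlignReplace k A B x y : align k A B -> align k.+1 (rcons A x) (rcons B y)
| AlignDelete k A B x : align k A B -> align k.+1 (rcons A x) B
| AlignInsert k A B y : align k A B -> align k.+1 A (rcons B y).

Lemma align_refl A : align 0 A A.
Proof. by elim/last_ind: A => [|A x IH]; [exact: AlignNil | exact: AlignMatch]. Qed.

Lemma edits_cat k A B s : edits k A B -> edits k (A ++ s) (B ++ s).
Proof.
elim=> {k A B} [A|k A B C AB _ IH]; first exact: Edits0.
apply: EditsS IH; case: AB => p q a *; rewrite -!catA /=.
- exact: Replace.
- exact: Delete.
- exact: Insert.
Qed.

Lemma edits_rcons_step k A B C : edits k A B -> edit_step B C -> edits k.+1 A C.
Proof.
elim=> {k A B} [A|k A B D AB _ IH] BC; first exact: EditsS BC (Edits0 _).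
exact: EditsS AB (IH BC).
Qed.

Lemma align_edits k A B : align k A B -> edits k A B.
Proof.
elim=> {k A B} [|k A B x _ IH|k A B x y _ IH|k A B x _ IH|k A B y _ IH].
- exact: Edits0.
- by rewrite -!cats1; apply: edits_cat.
- apply: (@edits_rcons_step _ _ (rcons B x)); first by rewrite -!cats1; apply: edits_cat.
  by rewrite -!cats1; apply: Replace.
- apply: (@edits_rcons_step _ _ (rcons B x)); first by rewrite -!cats1; apply: edits_cat.
  by have := @Delete T B [::] x; rewrite cats0 cats1.
- apply: (edits_rcons_step IH).
  by have := @Insert T B [::] y; rewrite cats0 cats1.
Qed.

(* One edit from [A] to [B] in front of an alignment can be absorbed. *)
Definition realign A B :=
  forall k C, align k B C -> exists2 k', k' <= k.+1 & align k' A C.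

Lemma realign_rcons A B x : realign A B -> realign (rcons A x) (rcons B x).
Proof.
move=> AB k C; move E: (rcons B x) => D DC.
elim: DC E => {k C D} [|k D C y DC _|k D C y z DC _|k D C y DC _|k D C y DC IH].
- by move/(congr1 size); rewrite size_rcons.
- move=> /rcons_inj[? ?]; subst D y.
  by have [k' le_k' AC] := AB _ _ DC; exists k' => //; apply: AlignMatch.
- move=> /rcons_inj[? ?]; subst D y.
  by have [k' le_k' AC] := AB _ _ DC; exists k'.+1 => //; apply: AlignReplace.
- move=> /rcons_inj[? ?]; subst D y.
  by have [k' le_k' AC] := AB _ _ DC; exists k'.+1 => //; apply: AlignDelete.
- by move=> /IH[k' le_k' AC]; exists k'.+1 => //; apply: AlignInsert.
Qed.

Lemma realign_cat A B s : realign A B -> realign (A ++ s) (B ++ s).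
Proof.
elim/last_ind: s => [|s x IH] AB; first by rewrite !cats0.
by rewrite -!rcons_cat; apply: realign_rcons (IH AB).
Qed.

(** Insertions on the right are peeled off until the step that treats [b]; there [b] is exchanged
    for [a], which at worst turns a match into a replacement. *)
Lemma realign_replace p a b : realign (rcons p a) (rcons p b).
Proof.
move=> k C; move E: (rcons p b) => D DC.
elim: DC E => {k C D} [|k D C y DC _|k D C y z DC _|k D C y DC _|k D C y DC IH].
- by move/(congr1 size); rewrite size_rcons.
- by move=> /rcons_inj[? ?]; subst D y; exists k.+1 => //; apply: AlignReplace.
- move=> /rcons_inj[? ?]; subst D y.
  by exists k.+1 => //; apply: AlignReplace.
- by move=> /rcons_inj[? ?]; subst D y; exists k.+1 => //; apply: AlignDelete.
- by move=> /IH[k' le_k' AC]; exists k'.+1 => //; apply: AlignInsert.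
Qed.

Lemma realign_insert p b : realign p (rcons p b).
Proof.
move=> k C; move E: (rcons p b) => D DC.
elim: DC E => {k C D} [|k D C y DC _|k D C y z DC _|k D C y DC _|k D C y DC IH].
- by move/(congr1 size); rewrite size_rcons.
- by move=> /rcons_inj[? ?]; subst D y; exists k.+1 => //; apply: AlignInsert.
- move=> /rcons_inj[? ?]; subst D y.
  by exists k.+1 => //; apply: AlignInsert.
- by move=> /rcons_inj[? ?]; subst D y; exists k => //; lia.
- by move=> /IH[k' le_k' AC]; exists k'.+1 => //; apply: AlignInsert.
Qed.

Lemma realign_delete p a : realign (rcons p a) p.
Proof. by move=> k C pC; exists k.+1 => //; apply: AlignDelete. Qed.

(** The operations are absorbed from the last to the first, starting from [align_refl]. The cost may
    drop, for instance when an inserted symbol is deleted later. *)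
Lemma edits_align k A B : edits k A B -> exists2 k', k' <= k & align k' A B.
Proof.
elim=> {k A B} [A|k A B C AB _ [k1 le_k1 BC]]; first by exists 0 => //; apply: align_refl.
suff [k' le_k' AC] : exists2 k', k' <= k1.+1 & align k' A C by exists k' => //; lia.
move: k1 C BC {le_k1}; rewrite -/(realign A B).
case: AB => p s a *; rewrite -?cat_rcons; apply: realign_cat.
- exact: realign_replace.
- exact: realign_delete.
- exact: realign_insert.
Qed.

Lemma EditP A B : align (Edit A B) A B /\ forall k, align k A B -> Edit A B <= k.
Proof.
rewrite /Edit; case: ex_minnP => e /asboolP eAB e_min; split; last first.
  by move=> k /align_edits kAB; apply/e_min/asboolP.
have [k le_k kAB] := edits_align eAB.
suff -> : e = k by [].
by apply/eqP; rewrite eqn_leq le_k andbT; apply/e_min/asboolP/align_edits.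
Qed.

(** The minimum behind [column] includes the empty window, that of [online_edit] does not. Turning
    the last deletion into a replacement by [y] passes to a one-symbol window at equal cost. *)
Lemma align_nil_singleton k A y : 0 < size A -> align k A [::] -> align k A [:: y].
Proof.
move=> + kA; move E: [::] kA => B kA; case: kA E => {k A B} //.
- by move=> k A B x _ /(congr1 size); rewrite size_rcons.
- by move=> k A B x z _ /(congr1 size); rewrite size_rcons.
- by move=> k A B x + E _; rewrite -E => kA; apply: (@AlignReplace k A [::]).
- by move=> k A B z _ /(congr1 size); rewrite size_rcons.
Qed.

End Alignment.

(** * The dynamic programming column *)

Section Column.
Variable T : eqType.
Implicit Types (F : seq T) (S : nat -> T) (a b : nat -> nat).

(** For [j] minus the distance, deletions and replacements keep the value, an insertion loses one
    and a match gains one. The symbol is optional because slots of a block buffer may be empty. *)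
Fixpoint step F (s : option T) a (j : nat) : nat :=
  if j is i.+1 then
    maxn (step F s a i) (maxn (a i.+1 - 1) (a i + (onth F i == s)))
  else 0.

(* [column F S t j] is [j] minus the minimum over [h <= t] of the edit distance
   between [take j F] and [S[h, t-1]]; [step] is the usual recurrence. *)
Fixpoint column F S t : nat -> nat :=
  if t is t'.+1 then step F (Some (S t')) (column F S t') else fun=> 0.

Lemma step_homo F s a : {homo step F s a : i j / i <= j}.
Proof. by apply: homo_leq leq_trans _ => // i /=; rewrite leq_maxl. Qed.

Lemma column_homo F S t : {homo column F S t : i j / i <= j}.
Proof. by case: t => [|t] // i j; apply: step_homo. Qed.

Lemma column_le F S t j : column F S t j <= j.
Proof.
elim: t j => [|t IHt] //= j; elim: j => //= j IHj.
rewrite !geq_max; have := IHt j; have := IHt j.+1; lia.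
Qed.

Lemma rcons_substream S h t :
  h <= t -> map S (index_iota h t.+1) = rcons (map S (index_iota h t)) (S t).
Proof. by move=> ht; rewrite /index_iota subSn // -[(t - h).+1]addn1 iotaD map_cat cats1 subnKC. Qed.

Lemma rcons_eq_substream S h t B y :
    rcons B y = map S (index_iota h t) ->
  exists t', [/\ t = t'.+1, h <= t', B = map S (index_iota h t') & y = S t'].
Proof.
case: t => [|t] E.
  by move/(congr1 size): E; rewrite size_rcons size_map size_iota.
have ht : h <= t.
  by move/(congr1 size): E; rewrite size_rcons size_map size_iota; lia.
by move: E; rewrite rcons_substream // => /rcons_inj[-> ->]; exists t.
Qed.

Lemma rcons_eq_take F j A x :
    rcons A x = take j F -> j <= size F ->
  exists j', [/\ j = j'.+1, j' < size F, A = take j' F & onth F j' = Some x].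
Proof.
case: j => [|j] E jF; first by rewrite take0 in E; move/(congr1 size): E; rewrite size_rcons.
move: E; rewrite (take_nth x) // => /rcons_inj[-> x_def]; exists j; split => //.
by rewrite onthE (nth_map x) // -x_def.
Qed.

(** Each constructor is dominated by one term of the maximum, and a deletion by monotonicity of the
    column. *)
Lemma leq_align_column F S k A B : align k A B ->
  forall j h t, j <= size F -> A = take j F -> B = map S (index_iota h t) ->
  j <= k + column F S t j.
Proof.
elim=> {k A B} [|k A B x _ IH|k A B x y _ IH|k A B x _ IH|k A B y _ IH] j h t jF.
- by move/(congr1 size); rewrite size_takel //= => <-.
- move=> /rcons_eq_take/(_ jF)[j' [-> j'F eA eF]].
  move=> /rcons_eq_substream[t' [-> ht' eB eS]] /=.
  by have := IH j' h t' (ltnW j'F) eA eB; rewrite eF eS eqxx; lia.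
- move=> /rcons_eq_take/(_ jF)[j' [-> j'F eA eF]].
  move=> /rcons_eq_substream[t' [-> ht' eB eS]] /=.
  by have := IH j' h t' (ltnW j'F) eA eB; lia.
- move=> /rcons_eq_take/(_ jF)[j' [-> j'F eA eF]] eB.
  have := IH j' h t (ltnW j'F) eA eB.
  have := @column_homo F S t j' j'.+1; lia.
- move=> eA /rcons_eq_substream[t' [-> ht' eB eS]].
  have := IH j h t' jF eA eB; case: j {jF eA} => //= j; lia.
Qed.

(** Tracing back a term that attains the maximum yields an alignment of exactly this cost. *)
Lemma column_align F S t j : j <= size F ->
  exists2 h, h <= t & align (j - column F S t j) (take j F) (map S (index_iota h t)).
Proof.
elim: t j => [|t IHt] j.
  move=> jF; exists 0 => //; elim: j jF => [|j IHj] jF; first by rewrite take0; apply: AlignNil.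
  have [x0 _] : exists x0 : T, True by case: F jF {IHj} => // x; exists x.
  by rewrite (take_nth x0) // subn0; have := IHj (ltnW jF); rewrite subn0; apply: AlignDelete.
elim: j => [|j IHj] jF.
  by exists t.+1 => //; rewrite take0 /index_iota subnn; apply: AlignNil.
have [x0 _] : exists x0 : T, True by case: F jF {IHj IHt} => // x; exists x.
have eF : onth F j = Some (nth x0 F j) by rewrite onthE (nth_map x0).
have del : column F S t.+1 j.+1 = column F S t.+1 j ->
    exists2 h, h <= t.+1 &
      align (j.+1 - column F S t.+1 j.+1) (take j.+1 F) (map S (index_iota h t.+1)).
  move=> ->; have [h ht hA] := IHj (ltnW jF); exists h => //.
  rewrite (take_nth x0) // subSn ?column_le //; exact: AlignDelete.
set m := column F S t.+1 j.+1 in del *.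
(* The positivity keeps the truncated subtraction exact; a zero entry falls under another case. *)
have : [\/ m = column F S t.+1 j, 0 < column F S t j.+1 /\ m = column F S t j.+1 - 1
         | m = column F S t j + (onth F j == Some (S t))].
  have : m = maxn (column F S t.+1 j)
    (maxn (column F S t j.+1 - 1) (column F S t j + (onth F j == Some (S t)))) by [].
  move: (column F S t.+1 j) (column F S t j.+1) (column F S t j + _) => x y z m_def.
  have [le_yzx|lt_xyz] := leqP (maxn (y - 1) z) x; first by apply: Or31; lia.
  by have [le_yz|lt_zy] := leqP (y - 1) z; [apply: Or33 | apply: Or32]; lia.
case=> [|[a_gt0 ->]|->]; first exact: del.
- have [h ht hA] := IHt _ jF; exists h; first exact: leqW.
  have -> : j.+1 - (column F S t j.+1 - 1) = (j.+1 - column F S t j.+1).+1.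
    by have := column_le F S t j.+1; lia.
  by rewrite rcons_substream //; apply: AlignInsert.
- have [h ht hA] := IHt _ (ltnW jF); exists h; first exact: leqW.
  rewrite rcons_substream // (take_nth x0) // eF.
  have le_aj := column_le F S t j.
  have [[<-]|_] := eqVneq (Some (nth x0 F j)) (Some (S t)).
    by rewrite addn1 subSS; apply: AlignMatch.
  by rewrite addn0 subSn //; apply: AlignReplace.
Qed.

Lemma bigmin_leq (I : eqType) (r : seq I) (E : I -> nat) x i :
  i \in r -> \big[minn/x]_(h <- r) E h <= E i.
Proof.
elim: r => // y r IH; rewrite inE big_cons geq_min => /predU1P[->|/IH ->].
  by rewrite leqnn.
by rewrite orbT.
Qed.

Lemma online_edit_column F S i :
  0 < size F -> online_edit F S i = size F - column F S i.+1 (size F).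
Proof.
move=> F_gt0; set n := size F; set v := n - _.
have v_min h : v <= Edit F (substream S h i).
  have [E_al _] := EditP F (substream S h i).
  have := leq_align_column E_al (leqnn n); rewrite take_size.
  by move=> /(_ S _ _ erefl erefl); rewrite -/n -/v; lia.
apply/eqP; rewrite eqn_leq; apply/andP; split; last first.
  by rewrite /online_edit; elim/big_ind: _ => // x y *; rewrite leq_min; apply/andP.
suff [h ht hA] : exists2 h, h <= i & align v F (substream S h i).
  have [_ /(_ _ hA)] := EditP F (substream S h i); apply: leq_trans.
  exact: (@bigmin_leq _ _ (fun h : 'I_i.+1 => Edit F (substream S h i)) _ _
            (mem_index_enum (Ordinal (ht : h < i.+1)))).
have [h] := @column_align F S i.+1 n (leqnn _); rewrite take_size -/v.
rewrite leq_eqVlt ltnS => /predU1P[->|]; last by exists h.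
rewrite /index_iota subnn /= => hA; exists i => //.
rewrite /substream rcons_substream // /index_iota subnn /=.
by apply: align_nil_singleton.
Qed.

End Column.

(** * Truncated columns and their encoding by jump positions *)

Section Summary.
Variables (T : eqType) (n : nat) (F : seq T).
Implicit Types (a b : nat -> nat) (s : option T) (l : nat).

(* [b] can stand for [a] during the next [l] arrivals. *)
Definition agree l a b :=
  b n = a n /\ forall j, j <= n -> maxn (a j) (a n - 2 * l) = maxn (b j) (a n - 2 * l).

Lemma agree_leq l l' a b : l' <= l -> agree l a b -> agree l' a b.
Proof. by move=> le_l [ab_n ab]; split=> // j /ab; lia. Qed.

Lemma agree_exact l a b : a n <= 2 * l -> agree l a b -> forall j, j <= n -> b j = a j.
Proof. by move=> le_an [_ ab] j /ab; lia. Qed.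

Lemma exact_agree l a b : (forall j, j <= n -> b j = a j) -> agree l a b.
Proof. by move=> ab; split=> [|j /ab->]; first exact: ab. Qed.

Lemma eq_step s a b j :
  (forall i, i <= j -> b i = a i) -> step F s b j = step F s a j.
Proof.
elim: j => //= j IH ab; rewrite IH => [|i ij]; last by apply: ab; lia.
by rewrite !ab.
Qed.

(** The last entry drops by at most one, so the new truncation level is at least [a n - 2 * l - 1].
    Entries above that level come from old entries above [a n - 2 * l - 2], the old truncation
    level. *)
Lemma agree_step s l a b : 0 < n ->
  agree l.+1 a b -> agree l (step F s a) (step F s b).
Proof.
move=> n_gt0 ab.
(* The first case is truncation at zero, where the two columns coincide. *)
have [le_an|lt_an] := leqP (a n) (2 * l.+1).
  have {}ab := agree_exact le_an ab.
  by apply: exact_agree => j jn; apply: eq_step => i ij; apply: ab; lia.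
have step_n c : c n - 1 <= step F s c n by rewrite -(prednK n_gt0) /=; lia.
have := step_n a; have := step_n b.
have steps j : j <= n ->
    maxn (step F s a j) (a n - 2 * l - 1) = maxn (step F s b j) (a n - 2 * l - 1).
  set K := a n - 2 * l - 1.
  have max2 x y x' y' : maxn x K = maxn x' K -> maxn y K = maxn y' K ->
    maxn (maxn x y) K = maxn (maxn x' y') K by lia.
  elim: j => //= j IH jn; apply: (max2 _ _ _ _ (IH (ltnW jn))); apply: (max2).
    by have := ab.2 _ jn; rewrite /K; lia.
  by have := ab.2 _ (ltnW jn); rewrite /K; lia.
have := steps n (leqnn n); rewrite ab.1 => ? ? ?; split; first by lia.
by move=> j /steps; lia.
Qed.

Definition replay (ss : seq (option T)) a := foldl (fun a s => step F s a) a ss.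

Lemma replay_cat ss ss' a : replay (ss ++ ss') a = replay ss' (replay ss a).
Proof. exact: foldl_cat. Qed.

Lemma column_replay S t m :
  column F S (t + m) = replay [seq Some (S i) | i <- iota t m] (column F S t).
Proof.
elim: m => [|m IH]; first by rewrite addn0.
by rewrite -[in RHS]addn1 iotaD map_cat replay_cat -IH addnS.
Qed.

Lemma replay_homo ss a :
  {homo a : i j / i <= j} -> {homo replay ss a : i j / i <= j}.
Proof.
by elim: ss a => //= s ss IH a a_homo; apply: IH; apply: step_homo.
Qed.

Lemma eq_replay ss a b :
  (forall j, j <= n -> b j = a j) -> forall j, j <= n -> replay ss b j = replay ss a j.
Proof.
elim: ss a b => //= s ss IH a b ab; apply: IH => j jn.
by apply: eq_step => i ij; apply: ab; lia.
Qed.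

Lemma agree_replay ss l a b : 0 < n ->
  agree (size ss + l) a b -> agree l (replay ss a) (replay ss b).
Proof.
by move=> n_gt0; elim: ss a b => //= s ss IH a b ab; apply: IH; apply: agree_step.
Qed.

(* A nondecreasing column truncated at [a n - 2 * l] takes at most [2 * l + 1]
   values, so it is determined by [a n] and the positions where it jumps. *)
Definition summarize l a : (2 * l).+1.-tuple 'I_n.+2 :=
  [tuple of inord (a n) ::
    [tuple inord (find (fun j => a n <= a j + v) (iota 0 n.+1)) | v < 2 * l]].

Definition expand m (c : m.-tuple 'I_n.+2) (j : nat) : nat :=
  head 0 (map val c) - count (fun x => j < x) (behead (map val c)).

Lemma expand_homo m (c : m.-tuple 'I_n.+2) : {homo expand c : i j / i <= j}.
Proof.
move=> i j ij; apply/leq_sub2l/sub_count => x /=; exact: leq_ltn_trans.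
Qed.

Lemma find_homo_gt a x j : {homo a : i j / i <= j} -> j <= n ->
  (j < find (fun j => x <= a j) (iota 0 n.+1)) = (a j < x).
Proof.
move=> a_homo jn; set P := fun j => _; have [lt_j|le_j] := ltnP j.
  by have := before_find 0 lt_j; rewrite nth_iota // add0n /P ltnNge => ->.
have hasP : has P (iota 0 n.+1) by rewrite has_find size_iota; exact: leq_ltn_trans le_j _.
have := nth_find 0 hasP; rewrite nth_iota; last exact: leq_ltn_trans le_j _.
by rewrite add0n {1}/P ltnNge => /leq_trans->//; apply: a_homo.
Qed.

Lemma count_ltn_iota x m : count (fun v => v < x) (iota 0 m) = minn x m.
Proof. by elim: m => [|m IH]; [rewrite minn0 | rewrite -addn1 iotaD count_cat IH /=; lia]. Qed.

(** The jump position of index [v] lies beyond [j] exactly when [a j + v < a n], so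
    [minn (a n - a j) (2 * l)] positions are subtracted from [a n]. *)
Lemma summarizeK l a j : {homo a : i j / i <= j} -> a n <= n -> j <= n ->
  expand (summarize l a) j = maxn (a j) (a n - 2 * l).
Proof.
move=> a_homo an jn.
have -> : expand (summarize l a) j =
    a n - count (fun v => a j + v < a n) (iota 0 (2 * l)).
  rewrite /expand /= inordK; last by lia.
  congr (_ - _); rewrite -val_enum_ord !count_map -enumT.
  apply: eq_count => v /=; rewrite inordK.
    by rewrite find_homo_gt // => i i' /a_homo; lia.
  by have := find_size (fun j => a n <= a j + v) (iota 0 n.+1); rewrite size_iota.
have -> : count (fun v => a j + v < a n) (iota 0 (2 * l)) = minn (a n - a j) (2 * l).
  by rewrite -count_ltn_iota; apply: eq_count => v; lia.
by have := a_homo _ _ jn; lia.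
Qed.

(** A summary of depth [l' >= l] truncates only below what [agree l] observes. *)
Lemma agree_summarize l l' a b :
  {homo b : i j / i <= j} -> a n <= n -> l <= l' ->
  agree l a b -> agree l a (expand (summarize l' b)).
Proof.
move=> b_homo an le_l ab.
have bn : b n <= n by rewrite ab.1.
split; first by rewrite summarizeK //; have := ab.1; lia.
by move=> j jn; rewrite summarizeK //; have := ab.1; have := ab.2 _ jn; lia.
Qed.

End Summary.

(** * Reading and writing runs of cells, with their costs *)

Section Cells.
Variables (w : nat) (X : Type).
Implicit Types (m : memory w) (p : program w X) (i len : nat).
Implicit Types (ws : seq (word w)).

(* Memory is split into disjoint unbounded regions: the overflow of the
   register ([None]), the summary of each level and each chunk of the stream. *)
Definition region := option (nat + nat).
Implicit Types (r : region).

Definition address r i : nat := pickle (r, i).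

Definition fetch m r i len := [seq m (address r j) | j <- iota i len].

Fixpoint put m r i ws : memory w :=
  if ws is v :: ws' then put (write m (address r i) v) r i.+1 ws' else m.

Definition puts m (rws : seq (region * seq (word w))) :=
  foldl (fun m x => put m x.1 0 x.2) m rws.

Fixpoint load r i len (k : seq (word w) -> program w X) : program w X :=
  if len is len'.+1 then
    Read (address r i) (fun v => load r i.+1 len' (fun ws => k (v :: ws)))
  else k [::].

Fixpoint loads (rs : seq region) len (k : seq (seq (word w)) -> program w X) :=
  if rs is r :: rs' then load r 0 len (fun ws => loads rs' len (fun wss => k (ws :: wss)))
  else k [::].

Fixpoint store r i ws p : program w X :=
  if ws is v :: ws' then Write (address r i) v (store r i.+1 ws' p) else p.

Definition stores (rws : seq (region * seq (word w))) p :=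
  foldr (fun x => store x.1 0 x.2) p rws.

(** The three components are bundled so that a single rewriting evaluates a prefix of a program. *)
Definition run p m := (result p m, memory_after p m, cost p m).

Definition charge Y Z (c : nat) (x : Y * Z * nat) := (x.1, c + x.2).

Lemma run_load r i len k m :
  run (load r i len k) m = charge len (run (k (fetch m r i len)) m).
Proof.
rewrite /run /charge /=; elim: len i k => //= len IH i k.
by have [-> -> ->] := IH i.+1 (fun ws => k (m (address r i) :: ws)).
Qed.

Lemma run_loads rs len k m :
  run (loads rs len k) m =
  charge (size rs * len) (run (k [seq fetch m r 0 len | r <- rs]) m).
Proof.
elim: rs k => //= r rs IH k.
by rewrite run_load IH /charge /= mulSn addnA.
Qed.

Lemma run_store r i ws p m :
  run (store r i ws p) m = charge (size ws) (run p (put m r i ws)).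
Proof.
rewrite /run /charge /=; elim: ws i m => //= v ws IH i m.
by have [-> -> ->] := IH i.+1 (write m (address r i) v).
Qed.

Lemma run_stores rws p m :
  run (stores rws p) m =
  charge (sumn [seq size x.2 | x <- rws]) (run p (puts m rws)).
Proof.
elim: rws m => //= x rws IH m.
by rewrite run_store IH /charge /= addnA.
Qed.

Lemma address_inj : injective (uncurry address).
Proof. by move=> [r i] [r' i'] /(pcan_inj pickleK). Qed.

Lemma put_other m r i ws r' j :
  (r' != r) || (j < i) -> put m r i ws (address r' j) = m (address r' j).
Proof.
elim: ws i m => //= v ws IH i m ne; rewrite IH ?/write; last first.
  by case/orP: ne => [->//|lt_ji]; rewrite ltnW ?orbT.
case: eqP => // /(@address_inj (_, _) (_, _))[rr ij].
by move: ne; rewrite rr ij eqxx ltnn.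
Qed.

Lemma fetch_put m r i ws : fetch (put m r i ws) r i (size ws) = ws.
Proof.
elim: ws i m => //= v ws IH i m; rewrite /fetch /= -/(fetch _ _ _ _) IH.
by rewrite put_other ?leqnn ?orbT // /write eqxx.
Qed.

Lemma fetch_put_other m r i ws r' j len :
  r' != r -> fetch (put m r i ws) r' j len = fetch m r' j len.
Proof. by move=> ne; apply: eq_map => x; rewrite put_other ?ne. Qed.

Lemma fetch_puts_other m rws r j len :
  r \notin unzip1 rws -> fetch (puts m rws) r j len = fetch m r j len.
Proof.
elim: rws m => //= x rws IH m; rewrite inE negb_or => /andP[ne r_rws].
by rewrite IH // fetch_put_other.
Qed.

Lemma fetch_puts m rws r ws : uniq (unzip1 rws) -> (r, ws) \in rws ->
  fetch (puts m rws) r 0 (size ws) = ws.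
Proof.
elim: rws m => //= x rws IH m /andP[x_rws rws_uniq]; rewrite inE.
case/predU1P=> [x_def|]; last exact: IH.
by rewrite -x_def /= in x_rws *; rewrite fetch_puts_other // fetch_put.
Qed.

Definition init_memory (content : region -> seq (word w)) : memory w :=
  fun a => if @unpickle (region * nat)%type a is Some (r, i)
           then nth (nseq_tuple w false) (content r) i else nseq_tuple w false.

Lemma fetch_init content r len : size (content r) = len ->
  fetch (init_memory content) r 0 len = content r.
Proof.
move=> <-; apply: (@eq_from_nth _ (nseq_tuple w false)).
  by rewrite size_map size_iota.
move=> i; rewrite size_map size_iota => lt_i.
by rewrite (nth_map 0) ?size_iota // nth_iota // /init_memory pickleK.
Qed.

End Cells.

Arguments puts : simpl never.

(** * Finite types stored in runs of cells *)

Section Code.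
Variables (w : nat) (Q : finType) (len : nat).

(** Since computation is free, any injection would do; matching ranks in two enumerations gives one
    as soon as [Q] has at most [2 ^ (w * len)] elements. *)
Definition code (q : Q) : seq (word w) :=
  nth (nseq_tuple len (nseq_tuple w false)) (enum {: len.-tuple (w.-tuple bool)})
      (enum_rank q).

Definition decode (ws : seq (word w)) : option Q := [pick q | code q == ws].

Lemma size_code q : size (code q) = len.
Proof. by rewrite size_tuple. Qed.

Lemma codeK : #|Q| <= 2 ^ (w * len) -> pcancel code decode.
Proof.
move=> cardQ q; rewrite /decode; case: pickP => [q' /eqP|/(_ q)/eqP//].
move/val_inj/eqP; rewrite nth_uniq ?enum_uniq //; last 2 first.
- by rewrite -cardT card_tuple card_tuple card_bool -expnM (leq_trans _ cardQ).
- by rewrite -cardT card_tuple card_tuple card_bool -expnM (leq_trans _ cardQ).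
by move/eqP/val_inj/enum_rank_inj->.
Qed.

End Code.

(* After [u.+1] blocks, [k] is the highest level to be rebuilt. It only depends on
   [u] modulo [2 ^ L], which is all that the algorithm remembers of [u]. *)
Section Ruler.
Variables (L u : nat).
Let c := u %% 2 ^ L.
Let k := logn 2 c.+1.

(** [u.+1] and [c.+1] differ by a multiple of [2 ^ L], hence of [2 ^ j]. *)
Lemma ruler_dvd j : j <= L -> (2 ^ j %| u.+1) = (j <= k).
Proof.
move=> jL; rewrite -pfactor_dvdn // {1}(divn_eq u (2 ^ L)) -addnS dvdn_addr //.
by rewrite dvdn_mull // dvdn_exp2l.
Qed.

Lemma ruler_dvd_pos : 2 ^ k %| c.+1.
Proof. by rewrite pfactor_dvdn. Qed.

Lemma ruler_pos_lt : c < 2 ^ L.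
Proof. by rewrite ltn_mod expn_gt0. Qed.

Lemma ruler_leq : k <= L.
Proof.
rewrite -(@leq_exp2l 2) //; apply: leq_trans ruler_pos_lt.
exact: dvdn_leq ruler_dvd_pos.
Qed.

(** Level [k'] was last rebuilt exactly [2 ^ k] blocks before [u.+1]: for [k < L], [u.+1] is an odd
    multiple of [2 ^ k]; for [k = L], level [L] serves as its own source. *)
Lemma ruler_anchor (k' := minn k.+1 L) : u %/ 2 ^ k' * 2 ^ k' + 2 ^ k = u.+1.
Proof.
have dvd_k : 2 ^ k %| u.+1 by rewrite ruler_dvd // ruler_leq.
rewrite /k'; have := ruler_leq; rewrite leq_eqVlt => /predU1P[kL|kL].
  have -> : minn k.+1 L = L by lia.
  rewrite kL in dvd_k *; have := divnS u (expn_gt0 2 L : 0 < 2 ^ L).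
  rewrite dvd_k => /(congr1 (muln^~ (2 ^ L))); rewrite divnK // => ->.
  by rewrite mulnDl mul1n addnC.
have -> : minn k.+1 L = k.+1 by lia.
have ndvd : (2 ^ k.+1 %| u.+1) = false by rewrite ruler_dvd // ltnn.
have -> : u %/ 2 ^ k.+1 = u.+1 %/ 2 ^ k.+1 by rewrite divnS ?expn_gt0 // ndvd.
have [q q_def] := dvdnP dvd_k.
rewrite q_def expnSr; rewrite q_def expnS dvdn_pmul2r ?expn_gt0 // in ndvd.
rewrite [q * _]mulnC divnMl ?expn_gt0 //.
rewrite {2}(divn_eq q 2) modn2; move: ndvd; rewrite dvdn2 => /negbFE->.
by rewrite mulnDr muln1; congr (_ + _); rewrite mulnCA.
Qed.

End Ruler.

(** * The algorithm, its invariant and its cost *)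

Section Algorithm.
(* Blocks have [l0] arrivals, levels range over [0 .. L], and [M] cells hold the
   control state or one block of symbols. *)
Variables (w n L l0 M : nat) (Sigma : finType).

Local Notation summary l := ((2 * l).+1.-tuple 'I_n.+2)%type.
Local Notation chunk := {ffun 'I_l0 -> option Sigma}.
(* Blocks completed modulo [2 ^ L], arrivals in the current block, current
   summary, and symbols of the current block. *)
Local Notation control := ('I_(2 ^ L).+1 * 'I_l0.+1 * summary l0 * chunk)%type.

Definition level_region j : region := Some (inl j).
Definition chunk_region x : region := Some (inr x).

Definition level_code j a : seq (word w) :=
  code w (2 ^ j * M) (summarize n (2 ^ j * l0) a).

(** The first cell of the control code is the register, so saving the control costs only [M.-1]
    probes, none when [M = 1]. *)
Definition finish (r : word w) (out : nat) (q : control) rws : program w (nat * word w) :=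
  stores ((None, behead (code w M q)) :: rws) (Return w (out, head r (code w M q))).

Definition symbols (bs : seq (word w)) : seq (option Sigma) :=
  if decode chunk M bs is Some bt then [seq bt i | i <- enum 'I_l0] else [::].

Definition level_column j (ws : seq (word w)) : nat -> nat :=
  if decode (summary (2 ^ j * l0)) (2 ^ j * M) ws is Some sg then expand sg
  else fun=> 0.

(** At a block end the chunk is stored first, so that the replay reads it back with the older ones;
    then levels [0] to [k] are all rebuilt from level [k']. The stale [bt'] left in the control is
    harmless, as its slots are refilled before the next block end. *)
Definition arrival (F : n.-tuple Sigma) (r : word w) (s : Sigma) : program w (nat * word w) :=
  load None 0 M.-1 (fun rs =>
  if decode control M (r :: rs) is Some (c, o, sg, bt) then
    let a := step F (Some s) (expand sg) in
    let bt' := [ffun i : 'I_l0 => if i == o :> nat then Some s else bt i] : chunk in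
    if o.+1 < l0 then
      finish r (n - a n) (c, inord o.+1, summarize n l0 a, bt') [::]
    else
      let k := logn 2 c.+1 in
      let k' := minn k.+1 L in
      stores [:: (chunk_region c, code w M bt')]
      (load (level_region k') 0 (2 ^ k' * M) (fun ws =>
       loads [seq chunk_region x | x <- iota (c.+1 - 2 ^ k) (2 ^ k)] M (fun wss =>
       let b := replay F (flatten [seq symbols bs | bs <- wss]) (level_column k' ws) in
       finish r (n - a n) (inord (c.+1 %% 2 ^ L), inord 0, summarize n l0 b, bt')
         [seq (level_region j, level_code j b) | j <- iota 0 k.+1])))
  else Return w (0, r)).

Definition initial_control : control :=
  (inord 0, inord 0, summarize n l0 (fun=> 0), [ffun=> None]).

Definition initial_content (r : region) : seq (word w) :=
  match r with
  | None => behead (code w M initial_control)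
  | Some (inl j) => level_code j (fun=> 0)
  | Some (inr _) => [::]
  end.

Definition hierarchical : algorithm w n Sigma :=
  Algorithm (fun=> (init_memory initial_content,
                    head (nseq_tuple w false) (code w M initial_control)))
            arrival.

Hypotheses (n_gt0 : 0 < n) (nL : n <= 2 ^ L) (l0_gt0 : 0 < l0) (M_gt0 : 0 < M).
Hypothesis card_control : #|{: control}| <= 2 ^ (w * M).
Hypothesis card_chunk : #|{: chunk}| <= 2 ^ (w * M).
Hypothesis card_summary : forall j, #|{: summary (2 ^ j * l0)}| <= 2 ^ (w * (2 ^ j * M)).

Variables (F : n.-tuple Sigma) (S : nat -> Sigma).

Local Notation col := (column F S).

Definition chunk_at z : chunk := [ffun i : 'I_l0 => Some (S (z * l0 + i))].

(* The arrivals are grouped in blocks of length [l0]; [u] is the number of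
   completed blocks and [o] the number of arrivals in the current one. *)
Definition invariant u o (m : memory w) (r : word w) : Prop :=
  [/\ o < l0,
      exists sg bt,
      [/\ r :: fetch m None 0 M.-1 =
            code w M ((inord (u %% 2 ^ L), inord o, sg, bt) : control),
          agree n (l0 - o) (col (u * l0 + o)) (expand sg)
        & forall i : 'I_l0, i < o -> bt i = Some (S (u * l0 + i))],
      forall j, j <= L -> exists2 sg : summary (2 ^ j * l0),
        fetch m (level_region j) 0 (2 ^ j * M) = code w (2 ^ j * M) sg
      & agree n (2 ^ j * l0) (col (u %/ 2 ^ j * 2 ^ j * l0)) (expand sg)
    & forall x, x < u %% 2 ^ L ->
        fetch m (chunk_region x) 0 M = code w M (chunk_at (u - u %% 2 ^ L + x))].

Lemma symbols_chunk_at z :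
  symbols (code w M (chunk_at z)) = [seq Some (S i) | i <- iota (z * l0) l0].
Proof.
rewrite /symbols codeK // -[z * l0]addn0 iotaDl -val_enum_ord -!map_comp.
by apply: eq_map => i; rewrite /= ffunE.
Qed.

Lemma flatten_symbols z q :
  flatten [seq symbols (code w M (chunk_at (z + x))) | x <- iota 0 q] =
  [seq Some (S i) | i <- iota (z * l0) (q * l0)].
Proof.
elim: q => [|q IH]; first by rewrite mul0n.
rewrite -addn1 iotaD map_cat flatten_cat IH /= cats0 symbols_chunk_at.
by rewrite [(q + 1) * _]mulnDl mul1n iotaD map_cat -mulnDl add0n.
Qed.

Lemma run_finish r out q rws m :
  run (finish r out q rws) m =
  (out, head r (code w M q), puts m ((None, behead (code w M q)) :: rws),
   M.-1 + sumn [seq size x.2 | x <- rws]).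
Proof. by rewrite /finish run_stores /charge /= addn0 size_behead size_code. Qed.

Lemma head_behead_code (q : control) r : head r (code w M q) :: behead (code w M q) = code w M q.
Proof. by have := size_code w M q; case: code => //= M0; move: M_gt0; rewrite -M0. Qed.

Lemma fetch_control m (q : control) rws :
  None \notin unzip1 rws ->
  fetch (puts m ((None, behead (code w M q)) :: rws)) None 0 M.-1 = behead (code w M q).
Proof.
move=> rws_None; rewrite /puts /= -/(puts _ _) fetch_puts_other //.
by rewrite -{2}(size_code w M q) -size_behead fetch_put.
Qed.

Lemma invariant_within u o m r (t := u * l0 + o) : invariant u o m r -> o.+1 < l0 ->
  exists m' r', invariant u o.+1 m' r' /\
    run (arrival F r (S t)) m = (n - col t.+1 n, r', m', M.-1 + M.-1).
Proof.
move=> [o_lt [sg [bt [ctl sg_ok bt_ok]]] lev_ok chk_ok] o_lt'.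
rewrite /arrival run_load ctl codeK //.
have cE : (inord (u %% 2 ^ L) : 'I_(2 ^ L).+1) = u %% 2 ^ L :> nat.
  by rewrite inordK // ltnW // ltnS ruler_pos_lt.
have oE : (inord o : 'I_l0.+1) = o :> nat by rewrite inordK // ltnW.
rewrite oE o_lt' run_finish /charge /= addn0.
set a := step _ _ _; set q : control := (_, _, summarize _ _ _, _); set m' := puts _ _.
have a_ok : agree n (l0 - o.+1) (col t.+1) a by apply: agree_step; rewrite // -subSn.
exists m', (head r (code w M q)); split; last by rewrite a_ok.1.
have keep ρ i len : ρ != None -> fetch m' ρ i len = fetch m ρ i len.
  by move=> ne; rewrite fetch_puts_other // inE.
split => //.
- exists (summarize n l0 a), [ffun i : 'I_l0 => if i == o :> nat then Some (S t) else bt i].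
  split.
  + by rewrite (@fetch_control m q [::]) // head_behead_code.
  + rewrite addnS; apply: agree_summarize a_ok; last by rewrite leq_subr.
      exact: step_homo.
    by apply: leq_trans (column_le _ _ _ _) _.
  + by move=> i; rewrite ltnS leq_eqVlt ffunE; case: eqP => [-> //|_ /=]; apply: bt_ok.
- by move=> j jL; rewrite keep //; apply: lev_ok.
- by move=> x xu; rewrite keep //; apply: chk_ok.
Qed.

Lemma sumn_levels k b :
  sumn [seq size x.2 | x <- [seq (level_region j, level_code j b) | j <- iota 0 k]] <=
  2 ^ k * M.
Proof.
elim: k => // k IH; rewrite -addn1 iotaD !map_cat sumn_cat /= size_code addn0 addn1.
by rewrite add0n expnS mul2n -addnn mulnDl leq_add2r.
Qed.

(** A summary of level [k.+1] is good for [2 ^ k.+1] blocks: the replay uses up half, and the other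
    half serves level [k] and those below. At [k = L] the source summary is exact because
    [n <= 2 ^ L], so nothing is used up. *)
Lemma column_rebuild u (c := u %% 2 ^ L) (k := logn 2 c.+1) (k' := minn k.+1 L)
    (sg : summary (2 ^ k' * l0)) (z := u %/ 2 ^ k' * 2 ^ k') j :
  j <= k ->
  agree n (2 ^ k' * l0) (col (z * l0)) (expand sg) ->
  agree n (2 ^ j * l0) (col (u.+1 * l0))
    (replay F [seq Some (S i) | i <- iota (z * l0) (2 ^ k * l0)] (expand sg)).
Proof.
move=> jk sg_ok; have zk : z + 2 ^ k = u.+1 by apply: ruler_anchor.
rewrite -zk mulnDl column_replay.
have := ruler_leq L u; rewrite -/c -/k leq_eqVlt => /predU1P[kL|kL].
  have k'L : k' = L by rewrite /k' kL; lia.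
  apply: exact_agree; apply: eq_replay; apply: agree_exact sg_ok.
  apply: leq_trans (column_le _ _ _ _) _; apply: leq_trans nL _; rewrite k'L.
  by rewrite mulnCA leq_pmulr // muln_gt0 l0_gt0.
apply: (@agree_leq _ (2 ^ k * l0)); first by rewrite leq_mul2r leq_exp2l ?jk ?orbT.
apply: agree_replay => //; rewrite size_map size_iota.
have k'k : k' = k.+1 by rewrite /k'; lia.
by move: sg_ok; rewrite {1}k'k expnS mul2n -addnn mulnDl.
Qed.

(** Besides the control, the probes are [M] to store the chunk, at most [2 * 2 ^ k * M] to load
    level [k'], [2 ^ k * M] to load chunks and at most [2 * 2 ^ k * M] to store the levels. *)
Lemma invariant_boundary u o m r (t := u * l0 + o) (k := logn 2 (u %% 2 ^ L).+1) :
  invariant u o m r -> o.+1 = l0 ->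
  exists m' r' cst,
  [/\ invariant u.+1 0 m' r', run (arrival F r (S t)) m = (n - col t.+1 n, r', m', cst)
    & cst <= 2 * M.-1 + 6 * 2 ^ k * M].
Proof.
move=> [o_lt [sg [bt [ctl sg_ok bt_ok]]] lev_ok chk_ok] o_l0.
rewrite /arrival run_load ctl codeK //.
set c := u %% 2 ^ L in k ctl lev_ok chk_ok *.
have c_lt : c < 2 ^ L by apply: ruler_pos_lt.
have cE : (inord c : 'I_(2 ^ L).+1) = c :> nat by rewrite inordK // ltnW.
have oE : (inord o : 'I_l0.+1) = o :> nat by rewrite inordK // ltnW.
rewrite oE cE o_l0 ltnn -/k; set k' := minn k.+1 L.
set a := step _ _ _.
(* The validity of the summary ends exactly here; [agree n 0] still fixes the last entry, which is
   the output. *)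
have a_ok : agree n 0 (col t.+1) a.
  by apply: agree_step => //; move: sg_ok; have -> : l0 - o = 1 by lia.
have -> : [ffun i : 'I_l0 => if i == o :> nat then Some (S t) else bt i] = chunk_at u.
  apply/ffunP => i; rewrite !ffunE; case: eqP => [->//|ne]; apply: bt_ok.
  by have := ltn_ord i; lia.
rewrite run_stores run_load run_loads; set m1 := puts m _.
have k'L : k' <= L by apply: geq_minr.
have [sg' m_sg' sg'_ok] := lev_ok _ k'L.
rewrite fetch_puts_other // m_sg' /level_column (codeK (card_summary k')).
set z := u %/ 2 ^ k' * 2 ^ k' in sg'_ok.
have zk : z + 2 ^ k = u.+1 by apply: ruler_anchor.
have k_c : 2 ^ k <= c.+1 by apply: dvdn_leq; rewrite ?ruler_dvd_pos.
have uE : u.+1 %% 2 ^ L = c.+1 %% 2 ^ L by rewrite -addn1 -modnDml addn1.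
have cu : c <= u by apply: leq_mod.
(* As [2 ^ k <= c.+1], all replayed blocks lie in the current cycle of [2 ^ L] blocks; the last is
   the chunk just stored. *)
have -> : [seq fetch m1 i 0 M | i <- [seq chunk_region x | x <- iota (c.+1 - 2 ^ k) (2 ^ k)]]
    = [seq code w M (chunk_at (z + x)) | x <- iota 0 (2 ^ k)].
  rewrite -[c.+1 - _]addn0 iotaDl -!map_comp; apply/eq_in_map => x; rewrite mem_iota => x_lt.
  have -> : z + x = u - c + (c.+1 - 2 ^ k + x) by lia.
  rewrite /comp; set y := _ - _ + x; have : y <= c by rewrite /y; lia.
  rewrite leq_eqVlt => /predU1P[->|y_c].
    by rewrite subnK // -[in LHS](size_code w M (chunk_at u)) fetch_puts ?mem_head.
  rewrite fetch_puts_other ?chk_ok // inE; apply/eqP => -[]; lia.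
rewrite -[[seq symbols bs | bs <- _]]map_comp flatten_symbols.
set b := replay _ _ _.
have b_ok j : j <= k -> agree n (2 ^ j * l0) (col (u.+1 * l0)) b.
  by move=> jk; apply: column_rebuild.
have b_homo : {homo b : i j / i <= j} by apply: replay_homo; apply: expand_homo.
rewrite run_finish /charge.
set q : control := (_, _, summarize _ _ _, _); set rws := [seq _ | j <- _].
set m' := puts _ _; eexists m', (head r (code w M q)), _; split; [|by rewrite a_ok.1|]; last first.
- have := sumn_levels k.+1 b; rewrite -/rws.
  move: (sumn [seq size x.2 | x <- rws]) => levels.
  rewrite /= !size_map !size_iota size_code addn0.
  have : 2 ^ k' <= 2 * 2 ^ k by rewrite -expnS leq_exp2l // geq_minl.
  rewrite expnS => le1 le2.
  have : 2 ^ k' * M <= 2 * 2 ^ k * M by rewrite leq_mul2r le1 orbT.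
  have : M <= 2 ^ k * M by rewrite leq_pmull // expn_gt0.
  by lia.
- have rwsE : unzip1 rws = [seq level_region j | j <- iota 0 k.+1].
    by rewrite /unzip1 -map_comp.
  have rws_None : None \notin unzip1 rws by rewrite rwsE; apply/mapP => -[].
  have rws_chunk x : chunk_region x \notin unzip1 rws by rewrite rwsE; apply/mapP => -[].
  have rws_uniq : uniq (unzip1 rws) by rewrite rwsE map_inj_uniq ?iota_uniq // => i j [].
  split => //.
  + exists (summarize n l0 b), (chunk_at u); split => //.
      rewrite fetch_control // head_behead_code; congr (code w M (_, _, _, _)).
      by rewrite uE.
    have b0_ok : agree n l0 (col (u.+1 * l0)) b.
      by have := b_ok _ (leq0n k); rewrite expn0 mul1n.
    rewrite subn0 addn0; apply: agree_summarize b0_ok => //.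
    by apply: leq_trans (column_le _ _ _ _) _.
  (* Levels up to [k] are now anchored at [u.+1]; higher ones keep their anchor since [2 ^ j] does
     not divide [u.+1]. *)
  + move=> j jL; have [jk|kj] := leqP j k.
      exists (summarize n (2 ^ j * l0) b).
        rewrite -[in LHS](size_code w (2 ^ j * M) (summarize n (2 ^ j * l0) b)).
        rewrite fetch_puts //; first by rewrite /= rws_None.
        rewrite inE; apply/orP; right; apply/mapP; exists j => //.
        by rewrite mem_iota.
      have dvd_j : 2 ^ j %| u.+1 by rewrite (ruler_dvd u jL).
      rewrite (divnK dvd_j); apply: agree_summarize (b_ok _ jk) => //.
      by apply: leq_trans (column_le _ _ _ _) _.
    have [sg'' m_sg'' sg''_ok] := lev_ok _ jL; exists sg''.
      rewrite fetch_puts_other ?fetch_puts_other //.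
      rewrite -[unzip1 _]/(None :: unzip1 rws) inE rwsE; apply/mapP => -[i]; rewrite mem_iota => ik [ji]; lia.
    by rewrite divnS ?expn_gt0 // (ruler_dvd u jL) -/c -/k leqNgt kj.
  + move=> x xc.
    (* At the end of a cycle no chunk is required any more. *)
    have [cL|c1_lt] := eqVneq c.+1 (2 ^ L).
      by move: xc; rewrite uE cL modnn.
    have c1 : u.+1 %% 2 ^ L = c.+1 by rewrite uE modn_small // ltn_neqAle c1_lt.
    rewrite c1 ltnS in xc *; rewrite subSS fetch_puts_other ?rws_chunk //.
    move: xc; rewrite leq_eqVlt => /predU1P[->|xc].
      by rewrite subnK // -[in LHS](size_code w M (chunk_at u)) fetch_puts ?mem_head.
    rewrite fetch_puts_other ?chk_ok // inE; apply/eqP => -[]; lia.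
Qed.

Lemma invariant_initial (mr := config hierarchical F S 0) : invariant 0 0 mr.1 mr.2.
Proof.
have homo0 : {homo (fun=> 0) : i j / i <= j} by [].
have agree0 l : agree n l (col 0) (expand (summarize n l (fun=> 0))).
  by apply: (@agree_summarize _ l) => //; apply: exact_agree.
split => //.
- exists (summarize n l0 (fun=> 0)), [ffun=> None]; split => //.
    rewrite /= fetch_init /= ?head_behead_code ?mod0n //.
    by rewrite size_behead size_code.
  by rewrite subn0.
- move=> j jL; exists (summarize n (2 ^ j * l0) (fun=> 0)).
    by rewrite /= fetch_init //= size_code.
  by rewrite div0n.
- by move=> x; rewrite mod0n.
Qed.

(** The bound is a sum over levels to make amortisation separate; at a block end the term of level
    [k] alone pays for the rebuilding. *)
Lemma invariant_next t m r : invariant (t %/ l0) (t %% l0) m r ->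
  exists m' r' cst,
  [/\ invariant (t.+1 %/ l0) (t.+1 %% l0) m' r',
      run (arrival F r (S t)) m = (n - col t.+1 n, r', m', cst)
    & cst <= 2 * M.-1 + \sum_(j < L.+1) (2 ^ j * l0 %| t.+1) * (6 * 2 ^ j * M)].
Proof.
move=> inv_t; have o_lt := ltn_pmod t l0_gt0.
have tE := divn_eq t l0; have := o_lt; rewrite leq_eqVlt => /predU1P[o_l0|o_lt'].
  have [m' [r' [cst []]]] := invariant_boundary inv_t o_l0.
  rewrite -tE => inv' run' cst_le; exists m', r', cst.
  have t1E : t.+1 = (t %/ l0).+1 * l0 by rewrite {1}tE -addnS o_l0 mulSn addnC.
  split; rewrite // ?t1E ?mulnK ?modnMl //.
  apply: leq_trans cst_le _; rewrite leq_add2l.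
  have k_lt : logn 2 (t %/ l0 %% 2 ^ L).+1 < L.+1 by rewrite ltnS ruler_leq.
  rewrite (bigD1 (Ordinal k_lt)) //= dvdn_pmul2r //.
  by rewrite (ruler_dvd (t %/ l0) (ruler_leq _ _)) leqnn mul1n leq_addr.
have [m' [r' [inv']]] := invariant_within inv_t o_lt'; rewrite -tE => run'.
exists m', r', (M.-1 + M.-1); split => //; last by rewrite mul2n -addnn leq_addr.
have t1E : t.+1 = t %/ l0 * l0 + (t %% l0).+1 by rewrite addnS -tE.
by rewrite [t.+1]t1E divnMDl // modnMDl (divn_small o_lt') (modn_small o_lt') addn0.
Qed.

Lemma invariant_config t (mr := config hierarchical F S t) :
  invariant (t %/ l0) (t %% l0) mr.1 mr.2.
Proof.
rewrite {}/mr; elim: t => [|t IH].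
  by rewrite div0n mod0n; apply: invariant_initial.
have [m' [r' [cst [inv' run' _]]]] := invariant_next IH.
move: run' inv'; rewrite [config _ _ _ t.+1]/=; case: config => m r /=.
by rewrite /run => -[-> -> _].
Qed.

Lemma output_hierarchical t : output hierarchical F S t = online_edit F S t.
Proof.
have [m' [r' [cst [_ run' _]]]] := invariant_next (invariant_config t).
rewrite online_edit_column ?size_tuple // /output /arrival_program /=.
by case: run' => ->.
Qed.

Lemma probes_hierarchical t :
  probes hierarchical F S t <=
    2 * M.-1 + \sum_(j < L.+1) (2 ^ j * l0 %| t.+1) * (6 * 2 ^ j * M).
Proof.
have [m' [r' [cst [_ run' cst_le]]]] := invariant_next (invariant_config t).
by apply: leq_trans cst_le; case: run' => _ _ <-.
Qed.

Lemma sum_dvdn q T : \sum_(t < T) (q %| t.+1) * q <= T.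
Proof.
have [->|q_gt0] := posnP q; first by rewrite big1 // => t _; rewrite muln0.
rewrite -big_distrl /=; suff -> : \sum_(t < T) (q %| t.+1) = T %/ q by apply: leq_trunc_div.
elim: T => [|T IH]; first by rewrite big_ord0 div0n.
by rewrite big_ord_recr /= IH divnS // addnC.
Qed.

(** Level [j] pays [6 * 2 ^ j * M] once per [2 ^ j * l0] arrivals, so each of the [L.+1] levels
    contributes the same amortised [6 * M / l0]. *)
Lemma sum_probes_hierarchical T :
  l0 * \sum_(t < T) probes hierarchical F S t <=
  T * (2 * M.-1 * l0 + 6 * M * L.+1).
Proof.
apply: (@leq_trans (l0 * \sum_(t < T)
   (2 * M.-1 + \sum_(j < L.+1) (2 ^ j * l0 %| t.+1) * (6 * 2 ^ j * M)))).
  by rewrite leq_mul2l; apply/orP; right; apply: leq_sum => t _; apply: probes_hierarchical.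
rewrite big_split /= mulnDr mulnDr leq_add //.
  by rewrite sum_nat_const card_ord mulnCA [l0 * _]mulnC.
have -> : T * (6 * M * L.+1) = \sum_(j < L.+1) T * (6 * M).
  by rewrite sum_nat_const card_ord [in RHS]mulnCA [L.+1 * _]mulnC.
rewrite exchange_big big_distrr /=; apply: leq_sum => j _.
apply: leq_trans (leq_mul (sum_dvdn (2 ^ j * l0) T) (leqnn (6 * M))).
rewrite -big_distrl /= -big_distrl /=.
by rewrite mulnCA -!mulnA leq_mul2l; apply/orP; right; lia.
Qed.

End Algorithm.

(** * Choice of the block length and of the number of cells *)

Lemma hierarchical_solves (d n w : nat) (Sigma : finType) (k := trunc_log 2 n) :
  1 < n -> 0 < w -> #|Sigma| <= n ^ d ->
  exists alg : algorithm w n Sigma,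
  forall (F : n.-tuple Sigma) (S : nat -> Sigma),
    (forall i, output alg F S i = online_edit F S i) /\
    forall T, w * \sum_(i < T) probes alg F S i <= 252 * (d + 7) * k ^ 2 * T.
Proof.
(* [L] bits code an element of ['I_n.+2]. The control fits in [D * L * l0] bits: [d] accounts for
   the symbols, [7] for the counters, the summary and rounding. *)
move=> n_gt1 w_gt0 card_Sigma; pose L := k.+2; pose D := d + 7.
have k_gt0 : 0 < k by rewrite trunc_log_gt0.
have n2L : n.+2 <= 2 ^ L.
  have := @trunc_log_ltn 2 n isT; rewrite -/k /L [2 ^ k.+2]expnS; lia.
have DL_gt0 : 0 < D * L by rewrite muln_gt0 /D addn_gt0 orbT.
(* Using [w.-1] instead of [w] gives [D * L * l0 < w] whenever [l0 > 1], hence [M = 1]. *)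
pose l0 := maxn 1 (w.-1 %/ (D * L)); pose M := (D * L * l0 %/ w).+1.
have l0_gt0 : 0 < l0 by rewrite leq_maxl.
have Mw : D * L * l0 <= w * M by rewrite [w * M]mulnC; apply/ltnW/ltn_ceil.
have w_l0 : w <= 2 * (D * L * l0).
  have := @ltn_ceil w.-1 _ DL_gt0; rewrite prednK // mulnC => w_le.
  apply: leq_trans w_le _; rewrite mulnCA leq_mul2l; apply/orP; right.
  by rewrite /l0; lia.
have M1w : M.-1 * w <= D * L * l0 by apply: leq_trunc_div.
(* Either [l0 = 1], or the control fits in the register and [M.-1 = 0]. *)
have M1l0 : M.-1 * l0 * w <= D * L * l0.
  have [l0_1|l0_big] := leqP (w.-1 %/ (D * L)) 1.
    have l0E : l0 = 1 by rewrite /l0; lia.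
    by move: M1w; rewrite l0E !muln1.
  suff -> : M.-1 = 0 by [].
  rewrite /M /= divn_small // /l0; have -> : maxn 1 (w.-1 %/ (D * L)) = w.-1 %/ (D * L) by lia.
  by rewrite mulnC; have := leq_trunc_div w.-1 (D * L); lia.
have card_le (Q : finType) b : #|Q| <= 2 ^ b -> b <= w * M -> #|Q| <= 2 ^ (w * M).
  by move=> Qb bM; apply: leq_trans Qb _; rewrite leq_exp2l.
have card_sum l : #|{: (2 * l).+1.-tuple 'I_n.+2}| <= 2 ^ (L * (2 * l).+1).
  by rewrite card_tuple card_ord expnM leq_exp2r.
have card_chk : #|{: {ffun 'I_l0 -> option Sigma}}| <= 2 ^ ((L * d).+1 * l0).
  rewrite card_ffun card_option card_ord expnM leq_exp2r // expnS mul2n -addnn -addn1.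
  rewrite leq_add ?expn_gt0 // (leq_trans card_Sigma) // expnM.
  by case: (d) => // d'; rewrite leq_exp2r //; lia.
have card_ctl : #|{: 'I_(2 ^ L).+1 * 'I_l0.+1 * (2 * l0).+1.-tuple 'I_n.+2 *
    {ffun 'I_l0 -> option Sigma}}| <= 2 ^ (L.+1 + l0 + L * (2 * l0).+1 + (L * d).+1 * l0).
  move: card_chk; move: (_ * l0) => e card_chk.
  rewrite !card_prod !card_ord !expnD; apply: leq_mul card_chk; apply: leq_mul (card_sum l0).
  apply: leq_mul; last exact: ltn_expl.
  by rewrite expnS mul2n -addnn -addn1 leq_add ?expn_gt0.
have card_sums j : #|{: (2 * (2 ^ j * l0)).+1.-tuple 'I_n.+2}| <= 2 ^ (w * (2 ^ j * M)).
  apply: leq_trans (card_sum _) _; rewrite leq_exp2l // [w * _]mulnCA.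
  apply: leq_trans (leq_mul (leqnn (2 ^ j)) Mw).
  have p_gt0 : 0 < 2 ^ j by rewrite expn_gt0.
  have : 1 <= 2 ^ j * l0 by rewrite muln_gt0 p_gt0.
  rewrite (_ : 2 ^ j * (D * L * l0) = L * (D * (2 ^ j * l0))); last by lia.
  rewrite leq_mul2l /D => q_gt0; apply/orP; right.
  move: (2 ^ j * l0) q_gt0 => q q_gt0; nia.
have M_gt0 : 0 < M by [].
have n_gt0 : 0 < n by lia.
have nL : n <= 2 ^ L by lia.
have size_ctl : L.+1 + l0 + L * (2 * l0).+1 + (L * d).+1 * l0 <= w * M.
  apply: leq_trans Mw; rewrite /D.
  have : L <= L * l0 by rewrite leq_pmulr.
  have : l0 <= L * l0 by rewrite leq_pmull.
  nia.
have size_chk : (L * d).+1 * l0 <= w * M by apply: leq_trans size_ctl; rewrite leq_addl.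
exists (@hierarchical w n L l0 M Sigma) => F S; split.
  move=> i; apply: output_hierarchical => //.
  - exact: card_le card_ctl size_ctl.
  - exact: card_le card_chk size_chk.
move=> T.
have := @sum_probes_hierarchical w n L l0 M Sigma n_gt0 nL l0_gt0 M_gt0
  (card_le _ _ card_ctl size_ctl) (card_le _ _ card_chk size_chk) card_sums F S T.
set Sum := \sum_(t < T) _ => le_Sum.
rewrite -(leq_pmul2l l0_gt0) mulnCA.
apply: leq_trans (leq_mul (leqnn w) le_Sum) _.
(* [M.-1 * w] is at most [D * L * l0], and [w] at most twice that. *)
have Mw' : M * w <= 3 * (D * L * l0).
  by have : M * w = w + M.-1 * w; [rewrite -mulSn prednK | lia].
have -> : w * (T * (2 * M.-1 * l0 + 6 * M * L.+1)) =
    T * (2 * (M.-1 * l0 * w) + 6 * (M * w) * L.+1) by lia.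
have -> : l0 * (252 * D * k ^ 2 * T) = T * (252 * D * k ^ 2 * l0) by lia.
rewrite leq_mul2l; apply/orP; right.
have L3k : L <= 3 * k by rewrite /L; lia.
(* The constant is [252 = 28 * 3 ^ 2]: [2 + 18 * L.+1 <= 28 * L] because [L >= 2], and
   [L <= 3 * k]. *)
apply: (@leq_trans (28 * (D * L * l0) * L)); last first.
  have : L * L <= 9 * k ^ 2 by rewrite -[9]/(3 ^ 2) -expnMn -mulnn leq_mul.
  move=> LL; have := leq_mul (leqnn (28 * D * l0)) LL; lia.
apply: leq_trans (leq_add (leq_mul (leqnn 2) M1l0) (leq_mul (leq_mul (leqnn 6) Mw') (leqnn L.+1))) _.
have -> : 28 * (D * L * l0) * L = D * L * l0 * (28 * L) by lia.
have -> : 2 * (D * L * l0) + 6 * (3 * (D * L * l0)) * L.+1 = D * L * l0 * (2 + 18 * L.+1) by lia.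
by rewrite leq_mul2l; apply/orP; right; rewrite /L; lia.
Qed.

(** * From the truncated binary logarithm to the real one *)

Import Order.TTheory GRing.Theory Num.Theory.
Local Open Scope ring_scope.

Lemma trunc_log_ln (R : realType) (n : nat) : (0 < n)%N ->
  (trunc_log 2 n)%:R * ln (2 : R) <= ln (n%:R : R).
Proof.
move=> n_gt0; rewrite mulr_natl -lnXn // ler_ln ?posrE ?exprn_gt0 ?ltr0n //.
by rewrite -natrX ler_nat trunc_logP.
Qed.

Theorem theorem3 (R : realType) (d : nat) :
  exists C : R,
  forall (n w : nat) (Sigma : finType),
    (1 < n)%N -> (0 < w)%N -> (#|Sigma| <= n ^ d)%N ->
  exists alg : algorithm w n Sigma,
  forall (F : n.-tuple Sigma) (S : nat -> Sigma),
    (forall i : nat, output alg F S i = online_edit F S i) /\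
    (forall T : nat,
       (\sum_(i < T) probes alg F S i)%N%:R
         <= C * (ln (n%:R : R) ^+ 2 / w%:R) * T%:R).
Proof.
have ln2_gt0 : 0 < ln (2 : R) by rewrite ln_gt0 // ltr1n.
(* Dividing by [ln 2 ^+ 2] converts the squared binary logarithm into the natural one. *)
exists ((252 * (d + 7))%N%:R / ln 2 ^+ 2) => n w Sigma n_gt1 w_gt0 card_Sigma.
have [alg alg_ok] := hierarchical_solves n_gt1 w_gt0 card_Sigma.
exists alg => F S; have [out_ok cost_ok] := alg_ok F S; split=> // T.
have w0 : (0 : R) < w%:R by rewrite ltr0n.
rewrite -(ler_pM2l w0) -natrM.
have := cost_ok T; rewrite -(ler_nat R) => /le_trans; apply.
rewrite mulrA [w%:R * _]mulrCA -!mulrA mulKf ?gt_eqF // !mulrA.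
rewrite natrM ler_wpM2r // natrM -!mulrA ler_wpM2l //.
rewrite [_^-1 * _]mulrC -expr2 ler_pdivlMr ?exprn_gt0 // natrX -exprMn lerXn2r ?nnegrE //.
- by rewrite mulr_ge0 // ltW.
- by rewrite ln_ge0 // ler1n ltnW.
- by rewrite trunc_log_ln // ltnW.
Qed.
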